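(* Let $n$, $a$, $q$ and $k$ be integers such that $n=qa$, $q\ge 3$ and $a\ge 4$. Then $$\beta_b(\overrightarrow{C}(n;1,a)) = \beta_b(\overrightarrow{C}(n;1,-(q-1)a)) = \begin{cases} (q+k)(a-2) & \text{if } q=k(a-1),\ k\ge 1,\\ a(q-1) & \text{if } a=kq+1,\ k\ge 2.\end{cases}$$
   Context: For integers $n\ge 3$ and $b_1,\dots,b_k$, the oriented circulant graph $\overrightarrow{C}(n;b_1,\dots,b_k)$ has vertex set $\{v_0,\dots,v_{n-1}\}$ and arc set $\{v_iv_{i+b_j} : 0\le i\le n-1,\ 1\le j\le k\}$, with subscripts taken modulo $n$ (negative $b_j$ allowed). $d(u,v)$ is the length of a shortest directed path from $u$ to $v$; $e(v)=\max_u d(v,u)$ is the eccentricity; $\mathrm{diam}$ is the maximum eccentricity. An independent broadcast on an oriented graph $\overrightarrow{G}$ is a function $f:V(\overrightarrow{G})\to\{0,\dots,\mathrm{diam}(\overrightarrow{G})\}$ with $f(v)\le e(v)$ for all $v$, and $d(u,v)>f(u)$ for all distinct $u,v$ with $f(u),f(v)>0$. Its cost is $\sigma(f)=\sum_v f(v)$, and $\beta_b(\overrightarrow{G})$ is the maximum cost of an independent broadcast on $\overrightarrow{G}$. *)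

(* Defs.v *)
From mathcomp Require Import all_boot all_order all_algebra.

Set Implicit Arguments.
Unset Strict Implicit.
Unset Printing Implicit Defensive.

Section Broadcast.

Variables (V : finType) (e : rel V).

(* Shortest paths have length < #|V|, so the search below finds the distance
   from u to v whenever v is reachable from u; otherwise it returns #|V|, which
   exceeds every finite distance. *)
Definition dist (u v : V) : nat :=
  find (fun l => [exists p : l.-tuple V, path e u p && (last u p == v)])
       (iota 0 #|V|).

Definition ecc (v : V) : nat := \max_(u : V) dist v u.

Definition diam : nat := \max_(v : V) ecc v.

Definition independent_broadcast (f : {ffun V -> 'I_diam.+1}) : bool :=
  [forall v, f v <= ecc v] &&
  [forall u, forall v, [&& u != v, 0 < f u & 0 < f v] ==> (f u < dist u v)].

Definition cost (f : {ffun V -> 'I_diam.+1}) : nat := \sum_(v : V) f v.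

Definition broadcast_number : nat :=
  \max_(f : {ffun V -> 'I_diam.+1} | independent_broadcast f) cost f.

End Broadcast.

Definition circulant (n : nat) (bs : seq int) : rel 'I_n :=
  fun i j => has (fun b => (Posz j == Posz i + b %[mod n])%Z) bs.

Arguments circulant n bs : clear implicits.

(* Main.v *)
Require Import Defs.
From Stdlib Require Import FunctionalExtensionality.
From mathcomp Require Import all_boot all_order all_algebra zify.

Set Implicit Arguments.
Unset Strict Implicit.
Unset Printing Implicit Defensive.

(** The vertex [v + x + y * a] lies at distance at most [x + y] from [v].  The
    upper bounds are packing arguments: every broadcasting vertex [v] claims
    [L (f v)] vertices in such a way that two claims can only meet if one of the
    two vertices lies within the broadcast range of the other, so the values
    [L (f v)] add up to at most [n].  The claim is an interval of Z/n starting at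
    [v] when [q = k (a - 1)], and an initial part of the sequence of cosets of
    the subgroup generated by [a] when [a = k q + 1].  With [d = a - 1] resp.
    [d = q], one has [m * d <= (d - 1) * L m], whence [beta <= (n / d) * (d - 1)].
    Equality holds because [d] divides [n] and both generators are 1 mod [d]: a
    path between distinct multiples of [d] has length at least [d], so all
    multiples of [d] can broadcast with value [d - 1]. *)

Local Arguments circulant : simpl never.

(** * Paths and distances in a finite digraph *)

Section Distance.
Variables (V : finType) (e : rel V).

Lemma dist_le_card u v : dist e u v <= #|V|.
Proof. by rewrite -[X in _ <= X](size_iota 0) find_size. Qed.

Lemma dist_le_path u p : path e u p -> dist e u (last u p) <= size p.
Proof.
(* The search is capped at [#|V|], so longer paths satisfy the bound trivially. *)
move=> up; case: (ltnP (size p) #|V|) => [ltpV|]; last first.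
  exact/leq_trans/dist_le_card.
rewrite leqNgt; apply/negP => /(before_find 0)/=.
by rewrite nth_iota // add0n => /negbT/existsPn/(_ (in_tuple p)); rewrite up eqxx.
Qed.

Lemma dist_path u v : dist e u v < #|V| ->
  exists p, [/\ path e u p, last u p = v & size p = dist e u v].
Proof.
move=> duv; have: has (fun l => [exists p : l.-tuple V,
    path e u p && (last u p == v)]) (iota 0 #|V|) by rewrite has_find size_iota.
move/(nth_find 0); rewrite nth_iota // add0n => /existsP[p /andP[up /eqP vE]].
by exists p; split=> //; rewrite size_tuple.
Qed.

Lemma dist_le_ecc u v : dist e u v <= ecc e u.
Proof. exact: (leq_bigmax (F := dist e u)). Qed.

Lemma ecc_le_diam v : ecc e v <= diam e.
Proof. exact: (leq_bigmax (F := ecc e)). Qed.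

End Distance.

Lemma circulantE n a (u v : 'I_n) : circulant n [:: 1%:Z; a%:Z]%R u v =
  (v == u + 1 %[mod n]) || (v == u + a %[mod n]).
Proof. by rewrite /circulant /= orbF -!PoszD !modz_nat !eqz_nat. Qed.

(** Since [n = q * a], the jump [-(q - 1) * a] equals [a - n], which is [a] modulo [n]. *)
Lemma circulant_opp n a q : n = q * a ->
  circulant n [:: 1%:Z; - ((q%:Z - 1) * a%:Z)]%R = circulant n [:: 1%:Z; a%:Z]%R.
Proof.
move=> nE; apply: functional_extensionality => u.
apply: functional_extensionality => v; rewrite /circulant /= !orbF.
congr (_ || (_ == _)).
rewrite -[in RHS](modzMDl (-1)); congr modz; lia.
Qed.

(** The pairs [(u, i)] with [i < L u] are sent injectively to [u + g i]: in a collision, ordered so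
    that [i <= j], the last hypothesis identifies the vertices and then injectivity of [g] the
    indices. *)
Lemma packing n (D : {pred 'I_n}) (L : 'I_n -> nat) (g : nat -> nat) :
  (forall u, u \in D -> L u <= n) ->
  (forall i j, i < n -> j < n -> g i = g j %[mod n] -> i = j) ->
  (forall u v i j, u \in D -> v \in D -> i <= j < L v ->
     u + g i = v + g j %[mod n] -> u = v) ->
  \sum_(u in D) L u <= n.
Proof.
case: n => [|n] in D L *; first by rewrite big1 // => [[]].
move=> Ln g_inj disj.
pose A := [pred s : 'I_n.+1 * 'I_n.+1 | (s.1 \in D) && (s.2 < L s.1)].
pose h (s : 'I_n.+1 * 'I_n.+1) : 'I_n.+1 := inord ((s.1 + g s.2) %% n.+1).
have hE s : h s = (s.1 + g s.2) %% n.+1 :> nat by rewrite inordK ?ltn_pmod.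
have -> : \sum_(u in D) L u = #|A|.
  rewrite -sum1_card.
  rewrite -(pair_big_dep (mem D) (fun u i : 'I_n.+1 => i < L u) (fun _ _ => 1)).
  apply: eq_bigr => u uD.
  by rewrite (big_ord_narrow (Ln u uD)) sum1_card card_ord.
rewrite -[X in _ <= X]card_ord; apply: (@leq_card_in _ _ h).
have hinj (s t : 'I_n.+1 * 'I_n.+1) :
    s \in A -> t \in A -> s.2 <= t.2 -> h s = h t -> s = t.
  case: s t => [u i] [v j] /andP[/= uD iL] /andP[/= vD jL] ij huv.
  have guv : u + g i = v + g j %[mod n.+1] by rewrite -!(hE (_, _)) huv.
  have uv : u = v by apply: disj guv; rewrite ?ij.
  rewrite {}uv in guv *; congr (_, _); apply: val_inj.
  apply: (g_inj _ _ (ltn_ord i) (ltn_ord j)).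
  by apply/eqP; rewrite -(eqn_modDl v) guv.
move=> s t sA tA huv; case/orP: (leq_total s.2 t.2) => st; first exact: hinj.
by apply/esym/hinj.
Qed.

(** * Distances in the circulant graph *)

Section Circulant.
Variables (n a q : nat).
Hypotheses (nE : n = q * a) (q_ge3 : 3 <= q) (a_ge4 : 4 <= a).
Local Notation e := (circulant n [:: 1%:Z; a%:Z]%R).

Let n_gt0 : 0 < n. Proof. by rewrite nE; nia. Qed.

Lemma dist_circulant_le (u v : 'I_n) x y :
  v = u + x + y * a %[mod n] -> dist e u v <= x + y.
Proof.
move=> vE.
suff [p [up sp lp]] : exists p,
    [/\ path e u p, size p = x + y & last u p = u + x + y * a %[mod n]].
  have <- : last u p = v.
    by apply: ord_inj; rewrite -(modn_small (ltn_ord v)) vE -lp modn_small.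
  by rewrite -sp dist_le_path.
move: {v vE} u; elim: x => [|x IHx] u; first elim: y u => [|y IHy] u.
- by exists [::]; split; rewrite //= mul0n !addn0.
- have [p [up sp lp]] := IHy (Ordinal (ltn_pmod (u + a) n_gt0)).
  exists (Ordinal (ltn_pmod (u + a) n_gt0) :: p); split=> /=.
  + by rewrite up circulantE /= modn_mod eqxx orbT.
  + by rewrite sp.
  + by rewrite lp /= !addn0 modnDml mulSn addnA.
- have [p [up sp lp]] := IHx (Ordinal (ltn_pmod (u + 1) n_gt0)).
  exists (Ordinal (ltn_pmod (u + 1) n_gt0) :: p); split=> /=.
  + by rewrite up circulantE /= modn_mod eqxx.
  + by rewrite sp addSn.
  + by rewrite lp /= -addnA modnDml addnA -(addnA u) add1n.
Qed.

(** Dividing the offset by [a] leaves at most [a - 1] unit jumps and [q - 1] jumps of length [a]. *)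
Lemma ecc_circulant_le v : ecc e v <= a + q - 2.
Proof.
apply/bigmax_leqP => u _; pose s := (u + n - v) %% n.
have sn : s < n by rewrite ltn_pmod.
have sq : s %/ a < q by rewrite ltn_divLR -?nE //; lia.
have sa : s %% a < a by rewrite ltn_pmod; lia.
apply: (@leq_trans (s %% a + s %/ a)); last by lia.
apply: dist_circulant_le; rewrite -addnA (addnC (s %% a)) -divn_eq modnDmr.
by rewrite subnKC ?modnDr // ltnW // ltn_addl.
Qed.

(** Every arc adds 1 modulo [d], so a path from [u] to [v] has length divisible by [d], and positive
    since [u != v]. *)
Lemma dist_circulant_ge d (u v : 'I_n) : d %| n -> a = 1 %[mod d] ->
  u != v -> u = v %[mod d] -> d <= dist e u v.
Proof.
(* If [v] is unreachable, the default distance [n] is still at least [d]. *)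
move=> dn ad uv uvd; case: (ltnP (dist e u v) n) => [lt|]; last first.
  exact/leq_trans/dvdn_leq.
have [|p [up vE <-]] := @dist_path _ e u v; first by rewrite card_ord.
have: last u p = u + size p %[mod d].
  elim: p u up {uv uvd lt vE} => [|w p IHp] u /=; first by rewrite addn0.
  rewrite circulantE => /andP[/orP uw /IHp ->].
  rewrite addnS -addSn -modnDml -[in RHS]modnDml; congr (_ %% d).
  congr (_ + _); rewrite -addn1.
  by case: uw => /eqP/(congr1 (modn^~ d)); rewrite !modn_dvdm // => -> //;
    rewrite -modnDmr ad modnDmr.
rewrite vE -uvd -[X in X %% d = _]addn0 => /eqP.
rewrite eqn_modDl mod0n eq_sym => /dvdn_leq; apply.
by case: p vE {up} uv => //= ->; rewrite eqxx.
Qed.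

(** * Lower bound on the broadcast number *)

Lemma card_multiples d : 0 < d -> d %| n -> \sum_(v < n) (d %| v) = n %/ d.
Proof.
move=> d0 dn; rewrite -(big_mkord xpredT (fun i => nat_of_bool (d %| i))).
(* The library counts multiples in [1..n]; here [n] is traded for 0. *)
have := divn_count_dvd d n; rewrite [X in _ = X]big_nat_recr //= dn => ->.
by rewrite (big_ltn n_gt0) dvdn0 addnC big_add1 -(prednK n_gt0).
Qed.

Lemma broadcast_number_ge d : 0 < d < n -> d %| n -> a = 1 %[mod d] ->
  n %/ d * d.-1 <= broadcast_number e.
Proof.
move=> /andP[d0 dltn] dn ad.
have ecc_ge (v : 'I_n) : d %| v -> d <= ecc e v.
  (* As [d < n], the vertex [v + d] differs from [v] and is congruent to it modulo [d]. *)
  move=> dv; pose w := Ordinal (ltn_pmod (v + d) n_gt0).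
  apply: leq_trans (dist_le_ecc _ v w); apply: dist_circulant_ge => //.
    apply: contraTneq dltn => /(congr1 val)/= /esym vw.
    have /eqP := etrans vw (esym (modn_small (ltn_ord v))).
    rewrite -[X in _ == X %[mod _]]addn0 eqn_modDl mod0n => /dvdn_leq.
    by rewrite -leqNgt; apply.
  by rewrite /= modn_dvdm // modnDr.
have dD : d.-1 < (diam e).+1.
  have := ecc_ge (Ordinal n_gt0) (dvdn0 d).
  have := ecc_le_diam e (Ordinal n_gt0); lia.
pose f : {ffun 'I_n -> 'I_(diam e).+1} :=
  [ffun v : 'I_n => if d %| v then Ordinal dD else ord0].
have -> : n %/ d * d.-1 = cost f.
  rewrite -card_multiples // big_distrl /cost /=; apply: eq_bigr => v _.
  by rewrite ffunE; case: ifP => _; rewrite ?mul1n.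
apply: (leq_bigmax_cond f (F := @cost _ e)); apply/andP; split.
  apply/forallP => v; rewrite ffunE; case: ifP => // /ecc_ge /=; lia.
apply/'forall_forallP => u v; apply/implyP => /and3P[uv].
rewrite !ffunE; case: ifP => //= du; case: ifP => //= dv _ _.
rewrite prednK //; apply: dist_circulant_ge => //.
by rewrite (eqP du) (eqP dv).
Qed.

(* [g] enumerates the claimed vertices relative to the broadcasting one, of
   which a vertex of value [m] claims the first [L m]. *)
Lemma broadcast_number_le d (L g : nat -> nat) :
  (forall m, 0 < m <= a + q - 2 -> L m <= n /\ m * d <= d.-1 * L m) ->
  (forall i j, i < n -> j < n -> g i = g j %[mod n] -> i = j) ->
  (forall m i j, 0 < m <= a + q - 2 -> i <= j < L m ->
     exists x y, x + y <= m /\ g i + x + y * a = g j %[mod n]) ->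
  broadcast_number e * d <= d.-1 * n.
Proof.
move=> Lm g_inj claim; rewrite /broadcast_number.
elim/big_ind: _ => // [x y lx ly|f]; first by rewrite maxnMl geq_max lx.
move=> /andP[/forallP f_ecc /'forall_forallP f_ind].
have fm u : 0 < f u -> 0 < f u <= a + q - 2.
  by move=> ->; exact: leq_trans (f_ecc u) (ecc_circulant_le u).
have pack : \sum_(u in [pred u | 0 < f u]) L (f u) <= n.
  apply: (@packing _ _ (fun u => L (f u)) g) => // [u /fm/Lm[]//|].
  move=> u v i j fu fv ij guv; apply/eqP; apply/negPn/negP => uv.
  (* A common claimed vertex gives [u = v + x + y * a] modulo [n], which puts [u] within range [f v]
     of [v]. *)
  have [x [y [xy gxy]]] := claim _ _ _ (fm v fv) ij.
  have /implyP := f_ind v u.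
  rewrite eq_sym uv (fu : 0 < f u) (fv : 0 < f v) => /(_ isT).
  rewrite ltnNge; apply/negP; rewrite negbK.
  apply: leq_trans xy; apply: dist_circulant_le; apply/eqP.
  rewrite -(eqn_modDr (g i)) guv -modnDmr -gxy modnDmr; apply/eqP.
  by congr (_ %% _); lia.
apply: (@leq_trans (d.-1 * \sum_(u in [pred u | 0 < f u]) L (f u))); last first.
  by rewrite leq_mul2l pack orbT.
rewrite /cost (bigID [pred u | 0 < f u]) /= [X in _ + X]big1 ?addn0.
  rewrite big_distrl big_distrr /=; apply: leq_sum => u /fm/Lm[] //.
by move=> u; rewrite -eqn0Ngt => /eqP.
Qed.

Lemma broadcast_number_dvd d : 0 < d < n -> d %| n -> a = 1 %[mod d] ->
  broadcast_number e * d <= d.-1 * n -> broadcast_number e = n %/ d * d.-1.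
Proof.
move=> dn dvd ad le; apply/eqP; rewrite eqn_leq broadcast_number_ge // andbT.
case/andP: dn => d0 _.
by rewrite mulnC -(leq_pmul2r d0) -mulnA (divnK dvd).
Qed.

Lemma broadcast_number_le_rows : broadcast_number e * a.-1 <= a.-1.-1 * n.
Proof.
(* [v + i] with [i < (m + 2 - a) * a] is in range since [i %% a <= a - 1] and
   [i %/ a <= m + 1 - a].  For [m = a - 1] these [a] vertices are one too few,
   but [v + a] is in range as well. *)
pose L m := if m < a.-1 then m.+1 else if m == a.-1 then a.+1 else (m + 2 - a) * a.
have aq : 3 * a <= n by rewrite nE leq_mul2r q_ge3 orbT.
apply: (@broadcast_number_le _ L id) => [m /andP[m0 mle]|i j ilt jlt|m i j].
- have [b bE] : exists b, a = b.+4 by exists (a - 4); lia.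
  rewrite /L; case: ltngtP => ma; split; try lia; try by rewrite bE /= in ma *; lia.
    (* The eccentricity bound on [m] limits the claim to [q] blocks of [a] vertices. *)
    by rewrite nE leq_mul2r; lia.
  have [t ->] : exists t, m = a + t by exists (m - a); lia.
  have -> : a + t + 2 - a = t + 2 by lia.
  by rewrite bE /=; lia.
- by rewrite !modn_small.
move=> _ /andP[ij jL]; exists ((j - i) %% a), ((j - i) %/ a); split; last first.
  by rewrite -addnA (addnC (_ %% a)) -divn_eq subnKC.
have {ij jL}: j - i < L m by exact: leq_ltn_trans (leq_subr _ _) jL.
move: (j - i) => {}i; have modi: i %% a < a by rewrite ltn_pmod; lia.
rewrite /L; case: (ltngtP m a.-1) => ma ilt.
- by rewrite modn_small ?divn_small; lia.
- have: i %/ a < m + 2 - a by rewrite ltn_divLR //; lia.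
  lia.
- have [ia|->] : i < a \/ i = a by lia.
    by rewrite modn_small ?divn_small; lia.
  by rewrite modnn divnn; lia.
Qed.

Lemma broadcast_number_le_cols : broadcast_number e * q <= q.-1 * n.
Proof.
(* The claimed vertices [v + x + y * a], [y < q], are ordered lexicographically
   by [(x, y)].  For [m >= q] the claim consists of the cosets
   [x <= m + 1 - q], on which any [y] is in range. *)
pose L m := if m < q then m.+1 else (m + 2 - q) * q.
have q0 : 0 < q by lia.
apply: (@broadcast_number_le _ L (fun i => i %/ q + (i %% q) * a)) => [m|i j|m i j].
- case/andP=> m0 mle; have [b bE] : exists b, q = b.+3 by exists (q - 3); lia.
  rewrite /L; case: ltnP => mq; split.
  + by rewrite nE; apply: leq_trans mq (leq_pmulr _ _); lia.
  + by rewrite bE /= in mq *; lia.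
  + by rewrite nE mulnC leq_mul2l; lia.
  have [t ->] : exists t, m = q + t by exists (m - q); lia.
  have -> : q + t + 2 - q = t + 2 by lia.
  by rewrite bE /=; lia.
(* The sum stays below [n], so division by [a] recovers [s %/ q] as remainder and [s %% q] as
   quotient. *)
- have gK s : s < n -> let t := (s %/ q + s %% q * a) %% n in
      s = (t %% a) * q + t %/ a.
    rewrite nE => slt; have xa : s %/ q < a by rewrite ltn_divLR // mulnC.
    have yq : s %% q < q by rewrite ltn_pmod.
    have tn : s %/ q + s %% q * a < q * a.
      apply: (@leq_trans ((s %% q).+1 * a)); last by rewrite leq_mul2r yq orbT.
      by rewrite mulSn ltn_add2r.
    rewrite /= (modn_small tn) (addnC (s %/ q)) modnMDl modn_small //.
    by rewrite divnMDl; [rewrite (divn_small xa) addn0 -divn_eq | lia].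
  by move=> /gK/= iE /gK/= jE gij; rewrite iE gij -jE.
- move=> _ /andP[ij jL].
  have xx : i %/ q <= j %/ q by apply: leq_div2r.
  have [y1 y2] : i %% q < q /\ j %% q < q by rewrite !ltn_pmod.
  have := divn_eq i q; have := divn_eq j q.
  move: (i %/ q) (j %/ q) (i %% q) (j %% q) xx y1 y2 => x x' y y' xx y1 y2 jE iE.
  move: xx; rewrite leq_eqVlt => /orP[/eqP xE | xx].
    exists 0, (y' - y); split; last by congr (_ %% _); nia.
    by move: jL; rewrite /L; case: ifP; nia.
  (* Since [q * a = n], jumps of length [a] count only modulo [q], so at most [q - 1] are needed. *)
  exists (x' - x), ((y' + q - y) %% q); split; last first.
    rewrite nE muln_modl modnDmr.
    have ya: (y + (y' + q - y)) * a = (y' + q) * a by congr (_ * _); lia.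
    rewrite -[in RHS](modnMDl 1); congr (_ %% _).
    by move: (y' + q - y) ya => dy; lia.
  have : (y' + q - y) %% q < q by rewrite ltn_pmod.
  (* For [m < q] this case is void: [j < q] forces [x' = 0]. *)
  have : x' < m + 2 - q by move: jL; rewrite /L; case: ifP; nia.
  lia.
Qed.

End Circulant.

Theorem theorem26 (n a q k : nat) (hn : n = q * a) (hq : 3 <= q) (ha : 4 <= a) :
  let beta := broadcast_number (circulant n [:: 1%:Z; a%:Z]%R) in
  let beta' :=
    broadcast_number (circulant n [:: 1%:Z; - ((q%:Z - 1) * a%:Z)]%R) in
  [/\ beta = beta',
      q = k * (a - 1) -> 1 <= k -> beta = (q + k) * (a - 2)
    & a = k * q + 1 -> 2 <= k -> beta = a * (q - 1)].
Proof.
move=> beta beta'; split=> [|qE k_gt0|aE k_gt1].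
- by rewrite /beta' circulant_opp.
- have nE : n = (q + k) * a.-1 by rewrite hn qE; nia.
  rewrite /beta (@broadcast_number_dvd n a q _ _ _ a.-1) //.
  + by rewrite nE mulnK; lia.
  + by rewrite nE; nia.
  + by rewrite nE dvdn_mull.
  + have aE : a = a.-1 + 1 by lia.
    by rewrite [X in X %% _ = _]aE modnDl.
  + exact: (@broadcast_number_le_rows n a q).
- rewrite /beta (@broadcast_number_dvd n a q _ _ _ q) //.
  + by rewrite hn mulKn; lia.
  + by rewrite hn; nia.
  + by rewrite hn dvdn_mulr.
  + by rewrite aE modnMDl.
  + exact: (@broadcast_number_le_cols n a q).
Qed.
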